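(* Let $t\ge0$, $d\ge1$, $b\ge2$ be fixed integers. For $m\ge t$, let $P_{b^m}$ be a deterministic $(t,m,d)$-net in base $b$, put $N=b^m$, and let $\widetilde P_{b^m}$ be obtained from $P_{b^m}$ by full Owen scrambling. Then there exist positive constants $c$ and $C$, depending only on $b,d,t$, such that, for every sufficiently large $m$ and every $1\le\lambda\le N^{1/d}$, with probability at least $1-C\lambda^{-1}$, $$ R_\infty(\widetilde P_{b^m})\le C\,N^{-3/(2d)}\lambda^{1/2}, \qquad \rho_\infty(\widetilde P_{b^m})\ge c\,N^{1/(2d)}\lambda^{-1/2}. $$ In particular, as $m\to\infty$, $$ R_\infty(\widetilde P_{b^m})=O_{\mathbb P}\left(N^{-3/(2d)}\right), \qquad \rho_\infty(\widetilde P_{b^m})=\Omega_{\mathbb P}\left(N^{1/(2d)}\right). $$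
   Context: A $b$-adic elementary interval in $[0,1)^d$ is a set $\prod_{j=1}^d[a_jb^{-k_j},(a_j+1)b^{-k_j})$ with $k_j\in\mathbb N_0$, $0\le a_j<b^{k_j}$. For $0\le t\le m$, a $(t,m,d)$-net in base $b$ is a $b^m$-point multiset in $[0,1)^d$ such that every $b$-adic elementary interval of volume $b^{t-m}$ contains exactly $b^t$ of its points. Full Owen scrambling in base $b$: independently for each coordinate $j$ and each finite digit prefix $a_1\cdots a_{r-1}\in\{0,\dots,b-1\}^{r-1}$ ($r\ge1$), choose a uniform random permutation $\pi_{j,a_1\cdots a_{r-1}}$ of $\{0,\dots,b-1\}$, all mutually independent. The $j$-th coordinate of every point, with base-$b$ digits $(a_r)_{r\ge1}$ (regular expansion, not ending in infinitely many digits $b-1$; for digital points, the specified output digits), is replaced by the number with digits $\widetilde a_r=\pi_{j,a_1\cdots a_{r-1}}(a_r)$. For an $N$-point multiset $P=(\boldsymbol x_n)_{0\le n<N}$ in $[0,1]^d$ with $N\ge2$: $R_\infty(P)=\min_{n<n'}\|\boldsymbol x_n-\boldsymbol x_{n'}\|_\infty$, $h_\infty(P)=\sup_{\boldsymbol z\in[0,1]^d}\min_{n}\|\boldsymbol z-\boldsymbol x_n\|_\infty$, $\rho_\infty(P)=2h_\infty(P)/R_\infty(P)$ ($=\infty$ if $R_\infty(P)=0$). Probabilistic order: $X_m=O_{\mathbb P}(a_m)$ means that for every $\varepsilon>0$ there are $C_\varepsilon>0$ and $m_\varepsilon$ with $\mathbb P(|X_m|>C_\varepsilon a_m)\le\varepsilon$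 for all $m\ge m_\varepsilon$; for positive $X_m$, $X_m=\Omega_{\mathbb P}(a_m)$ means $a_m/X_m=O_{\mathbb P}(1)$. *)

(* Defs.v *)
From HB Require Import structures.
From mathcomp Require Import all_boot all_order all_algebra all_fingroup.
From mathcomp Require Import all_classical all_reals all_analysis.
Import Order.TTheory GRing.Theory Num.Theory.
Import numFieldNormedType.Exports.

Set Implicit Arguments.
Unset Strict Implicit.
Unset Printing Implicit Defensive.

Local Open Scope classical_set_scope.
Local Open Scope ring_scope.

(* An N-point multiset in R^d is a family x : 'I_N -> 'rV[R]_d.  The norm
   `|_| that the library puts on 'rV[R]_d is the max norm. *)

Section Nets.
Variables (R : realType) (b d : nat).

Definition elementary_interval (k a : 'I_d -> nat) : set 'rV[R]_d :=
  [set x | forall j, (a j)%:R / b%:R ^+ k j <= x 0 j < (a j).+1%:R / b%:R ^+ k j].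

Definition is_net (t m : nat) (x : 'I_(b ^ m) -> 'rV[R]_d) : Prop :=
  [/\ (t <= m)%N,
      forall n j, 0 <= x n 0 j < 1
    & forall k a : 'I_d -> nat,
        (forall j, (a j < b ^ k j)%N) ->
        \prod_(j < d) (b%:R ^+ k j)^-1 = b%:R ^+ t / b%:R ^+ m :> R ->
        #|[pred n | x n \in elementary_interval k a]| = (b ^ t)%N].

End Nets.

Section Scrambling.
Variables (R : realType) (b : nat).

(* The entry e r is the (r+1)-st digit. *)
Definition digits_value (e : nat -> 'I_b) : R :=
  limn (series (fun r => (e r)%:R / b%:R ^+ r.+1 : R)).

(* Digits to which the scrambling is applied.  Every base-b expansion of the
   coordinates is admitted: the regular expansion, and also one that is
   specified along with the point and may end in infinitely many b-1
   (as can happen for the output digits of a digital point). *)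
Definition are_digits d N (x : 'I_N -> 'rV[R]_d)
    (e : 'I_N -> 'I_d -> nat -> 'I_b) : Prop :=
  forall n j, digits_value (e n j) = x n 0 j.

(* pi j w is the permutation attached to coordinate j and digit prefix w. *)
Definition owen_permutations d disp (Omega : measurableType disp)
    (P : probability Omega R)
    (pi : 'I_d -> seq 'I_b -> Omega -> {perm 'I_b}) : Prop :=
  [/\ forall j w (s : {perm 'I_b}), measurable [set o | pi j w o = s],
      forall j w (s : {perm 'I_b}),
        P [set o | pi j w o = s] = ((b`!)%:R^-1)%:E
    & forall (I : seq ('I_d * seq 'I_b)) (S : 'I_d * seq 'I_b -> {set {perm 'I_b}}),
        uniq I ->
        P (\bigcap_(i in [set` I]) [set o | pi i.1 i.2 o \in S i]) =
        (\prod_(i <- I) P [set o | pi i.1 i.2 o \in S i])%E].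

Definition scramble d N (Omega : Type)
    (pi : 'I_d -> seq 'I_b -> Omega -> {perm 'I_b})
    (e : 'I_N -> 'I_d -> nat -> 'I_b) (o : Omega) : 'I_N -> 'rV[R]_d :=
  fun n => \row_j digits_value (fun r => pi j (mkseq (e n j) r) o (e n j r)).

End Scrambling.

Section MeshRatio.
Variables (R : realType) (d N : nat).
Implicit Type x : 'I_N -> 'rV[R]_d.

(* For N >= 2 the infima below are over finite nonempty sets, i.e. minima. *)
Definition separation x : R :=
  inf [set `|x p.1 - x p.2| | p in [set p : 'I_N * 'I_N | (p.1 < p.2)%N]].

Definition cube : set 'rV[R]_d := [set z | forall j, 0 <= z 0 j <= 1].

Definition fill_distance x : R :=
  sup [set inf [set `|z - x n| | n in setT] | z in cube].

Definition mesh_ratio x : \bar R :=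
  if separation x == 0 then +oo%E
  else (2 * fill_distance x / separation x)%:E.

End MeshRatio.

Section ProbabilisticOrder.
Variables (R : realType) (disp : nat -> measure_display).
Variables (Omega : forall m, measurableType (disp m)).
Variables (P : forall m, probability (Omega m) R).
Implicit Types (X : forall m, Omega m -> \bar R) (a : nat -> R).

Definition bigO_P X a : Prop :=
  forall eps : R, 0 < eps ->
    exists C : R, 0 < C /\
    exists m_eps : nat, forall m, (m_eps <= m)%N ->
      (P m [set o | (C * a m)%:E < `|X m o|] <= eps%:E)%E.

(* In \bar R one has (+oo)^-1 = 0, so a_m / X_m = 0 where X_m = +oo. *)
Definition bigOmega_P X a : Prop :=
  bigO_P (fun m o => (a m)%:E / X m o)%E (fun _ => 1).

End ProbabilisticOrder.

(* Main.v *)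
Require Import Defs.
From HB Require Import structures.
From mathcomp Require Import all_boot all_order all_algebra all_fingroup.
From mathcomp Require Import all_classical all_reals all_analysis.
From mathcomp Require Import measurable_realfun ring lra zify.
Import Order.TTheory GRing.Theory Num.Theory.
Import numFieldNormedType.Exports.

(** Owen scrambling keeps the points of a net spread out on the scale [N^(-1/d)],
    but independently in the different boxes of that side, and so, somewhere among
    the [N] boxes, two points are likely to come far closer than that.

    Let [k] be the level at which the boxes of side [b^-k] hold more than [2^d]
    points each; then [b^k] is [N^(1/d)] up to a constant.  The first [k] digits of a
    coordinate are determined by the box up to one alternative (a coordinate may be
    given by an expansion ending in digits [b-1]), so every box holds two points with
    the same first [k] digits in all coordinates: [net_close_pair].  In one
    coordinate, the scrambling sends the first digits in which the two points
    differ to 0 and 1, the next digits of the one to [b-1] and those of the other to 0, up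
    to position [k+s], with probability at least [b^(-2s)] ([prod_steer_frac]); the
    two coordinates are then within [2 b^(-k-s)] of each other ([steer_close]).

    Hence about [N b^(-2sd)] boxes should have all their coordinates steered in this
    way.  Boxes with different digit prefixes in all coordinates are independent, and
    each coordinate with a common prefix costs at most a factor [b^(2s)].  A second moment estimate
    ([second_moment]) for the number of steered boxes, each weighted by the
    inverse of its probability, bounds the probability that there is none by
    [(1 + 3 b^(2s) / b^k)^d - 1] ([prob_some_steered]).  With [b^(2s)] of order
    [N^(1/d) / lambda] this is [O(1/lambda)], and the separation is then
    at most of order [b^(-k-s)], that is [N^(-3/(2d)) lambda^(1/2)].

    The fill distance of any [N] points is at least of order [N^(-1/d)], because a grid
    with more than [N] cells has an empty cell ([fill_distance_ge]).  So the bound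
    on the mesh ratio holds wherever the one on the separation does, and the two
    events of the theorem are one.  For the bounds in probability, take [lambda] to be a
    multiple of [1/eps]; the event about the mesh ratio is then a different one, and
    measuring it requires the fill distance to be measurable
    ([measurable_fill_distance]). *)

Set Implicit Arguments.
Unset Strict Implicit.
Unset Printing Implicit Defensive.
Local Open Scope classical_set_scope.
Local Open Scope ring_scope.

(** * Digit expansions *)

Section DigitPrefixes.
Variable b : nat.

Fixpoint prefix_int (f : nat -> 'I_b) (n : nat) : nat :=
  if n is n'.+1 then (prefix_int f n' * b + f n')%N else 0%N.

Lemma eq_prefix_int (f g : nat -> 'I_b) n :
  mkseq f n = mkseq g n -> prefix_int f n = prefix_int g n.
Proof.
elim: n => [//|n IH]; rewrite !mkseqS => /rcons_inj[/IH pfg fgn] /=.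
by rewrite pfg fgn.
Qed.

Lemma prefix_int_inj (f g : nat -> 'I_b) n :
  prefix_int f n = prefix_int g n -> mkseq f n = mkseq g n.
Proof.
elim: n => [//|n IH] /=.
move=> fg; have b0 : (0 < b)%N := leq_ltn_trans (leq0n _) (ltn_ord (f n)).
have /IH pfg : prefix_int f n = prefix_int g n.
  by move/(congr1 (divn^~ b)): fg; rewrite !divnMDl // !divn_small ?addn0.
have fgn : f n = g n.
  by apply: val_inj; move/(congr1 (modn^~ b)): fg; rewrite !modnMDl !modn_small.
by rewrite !mkseqS pfg fgn.
Qed.

Lemma mkseq_prefix (f g : nat -> 'I_b) i n : (i <= n)%N ->
  mkseq f n = mkseq g n -> mkseq f i = mkseq g i.
Proof.
move=> le_in /(congr1 (take i)).
by rewrite /mkseq -!map_take take_iota; move/minn_idPl: le_in => ->.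
Qed.

(** Digits after position [n] are at most [b - 1]: they cannot carry. *)
Lemma prefix_int_split (f : nat -> 'I_b) n l :
  (prefix_int f n * b ^ l <= prefix_int f (n + l) < (prefix_int f n).+1 * b ^ l)%N.
Proof.
elim: l => [|l /andP[IH1 IH2]]; first by rewrite addn0 !muln1 leqnn ltnS leqnn.
rewrite addnS /= expnSr !mulnA; apply/andP; split.
  by rewrite (leq_trans _ (leq_addr _ _))// leq_mul2r IH1 orbT.
have := ltn_ord (f (n + l)%N); move: IH2.
set A := prefix_int f (n + l); set B := (_ * _)%N => AB fb.
apply: (@leq_trans (A.+1 * b)%N); last by rewrite leq_mul2r AB orbT.
by rewrite mulSn addnC ltn_add2r.
Qed.

End DigitPrefixes.

Section DigitValues.
Variables (R : realType) (b : nat).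
Implicit Type f : nat -> 'I_b.

Lemma digit_base_gt0 f : 0 < b%:R :> R.
Proof. by rewrite ltr0n (leq_ltn_trans (leq0n _) (ltn_ord (f 0%N))). Qed.

Lemma series_digits f n :
  series (fun r => (f r)%:R / b%:R ^+ r.+1 : R) n = (prefix_int f n)%:R / b%:R ^+ n.
Proof.
have b0 := digit_base_gt0 f.
elim: n => [|n IH]; first by rewrite seriesEnat /= big_geq // mul0r.
rewrite -[LHS](subrK (series (fun r => (f r)%:R / b%:R ^+ r.+1 : R) n)).
rewrite seriesSB IH /= natrD natrM exprS.
by field; rewrite expf_neq0 gt_eqF.
Qed.

Lemma series_digits_ge f n l :
  (prefix_int f n)%:R / b%:R ^+ n <=
  series (fun r => (f r)%:R / b%:R ^+ r.+1 : R) (n + l).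
Proof.
have b0 := digit_base_gt0 f; have /andP[+ _] := prefix_int_split f n l.
rewrite series_digits -(ler_nat R) natrM natrX exprD => h.
rewrite ler_pdivrMr ?exprn_gt0 //.
by rewrite invfM mulrA mulrAC divfK ?gt_eqF ?exprn_gt0 // ler_pdivlMr ?exprn_gt0.
Qed.

Lemma series_digits_le f n l :
  series (fun r => (f r)%:R / b%:R ^+ r.+1 : R) (n + l) <=
  (prefix_int f n).+1%:R / b%:R ^+ n.
Proof.
have b0 := digit_base_gt0 f; have /andP[_ /ltnW] := prefix_int_split f n l.
rewrite series_digits -(ler_nat R) natrM natrX exprD => h.
rewrite ler_pdivlMr ?exprn_gt0 //.
by rewrite invfM mulrA mulrAC divfK ?gt_eqF ?exprn_gt0 // ler_pdivrMr ?exprn_gt0.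
Qed.

Lemma is_cvg_series_digits f :
  cvgn (series (fun r => (f r)%:R / b%:R ^+ r.+1 : R)).
Proof.
apply: nondecreasing_is_cvgn.
  apply/nondecreasing_seqP => n; rewrite -subr_ge0 seriesSB.
  by rewrite divr_ge0 ?exprn_ge0 ?ler0n.
exists ((prefix_int f 0).+1%:R / b%:R ^+ 0) => _ [n _ <-].
exact: (series_digits_le f 0 n).
Qed.

Lemma digits_value_ge f n : (prefix_int f n)%:R / b%:R ^+ n <= digits_value R f.
Proof.
apply: limr_ge; first exact: is_cvg_series_digits.
near=> l; have -> : l = (n + (l - n))%N by rewrite subnKC //; near: l; exists n.
exact: series_digits_ge.
Unshelve. all: by end_near. Qed.

Lemma digits_value_le f n :
  digits_value R f <= (prefix_int f n).+1%:R / b%:R ^+ n.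
Proof.
apply: limr_le; first exact: is_cvg_series_digits.
near=> l; have -> : l = (n + (l - n))%N by rewrite subnKC //; near: l; exists n.
exact: series_digits_le.
Unshelve. all: by end_near. Qed.

End DigitValues.

(** * Steering two digit sequences together *)

Section PermutationCounts.
Variable T : finType.

Lemma card_perm_at (x y : T) :
  (#|{: {perm T}}| <= #|T| * #|[set s : {perm T} | s x == y]%SET|)%N.
Proof.
rewrite -[X in (X <= _)%N]sum1_card (partition_big (fun s : {perm T} => s x) predT) //=.
rewrite -sum_nat_const; apply: leq_sum => z _.
rewrite sum1dep_card -(card_imset _ (mulIg (tperm z y))).
apply/subset_leq_card/fintype.subsetP => _ /imsetP[s + ->]; rewrite !inE => /eqP sx.
by rewrite permM sx tpermL.
Qed.

(** The symmetric group is 2-transitive, so any two ordered pairs of distinct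
    values are equally likely at two given places. *)
Lemma card_perm_at2 (x x' y y' : T) : x != x' -> y != y' ->
  (#|{: {perm T}}| <=
   #|T| ^ 2 * #|[set s : {perm T} | (s x == y) && (s x' == y')]%SET|)%N.
Proof.
move=> xx' yy'.
rewrite -[X in (X <= _)%N]sum1_card.
rewrite (partition_big (fun s : {perm T} => (s x, s x')) predT) //=.
rewrite -mulnn -card_prod -sum_nat_const; apply: leq_sum => -[z z'] _.
rewrite sum1dep_card.
have [->|zz'] := eqVneq z z'.
  rewrite (_ : finset _ = finset.set0) ?cards0 //; apply/setP => s; rewrite !inE.
  apply/negbTE; apply: contra xx' => /eqP[sx sx'].
  by rewrite -(inj_eq (@perm_inj _ s)) sx sx'.
pose z1 := tperm z y z'; pose r := (tperm z y * tperm z1 y')%g.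
have yz1 : y != z1 by rewrite -(tpermL z y) (inj_eq perm_inj).
have rz : r z = y by rewrite permM tpermL tpermD // eq_sym.
have rz' : r z' = y' by rewrite permM tpermL.
rewrite -(card_imset _ (mulIg r)).
apply/subset_leq_card/fintype.subsetP => _ /imsetP[s + ->]; rewrite !inE.
by move=> /eqP[sx sx']; rewrite !permM sx sx' -!permM rz rz' !eqxx.
Qed.

End PermutationCounts.

(** The probability that a uniform random permutation falls in [S]. *)
Definition perm_frac (R : realType) (b : nat) (S : {set {perm 'I_b}}) : R :=
  #|S|%:R / (b`!)%:R.

Section PermFrac.
Variables (R : realType) (b : nat).
Implicit Type S : {set {perm 'I_b}}.
Let b0 : 0 < (b`!)%:R :> R. Proof. by rewrite ltr0n fact_gt0. Qed.

Lemma card_perm_ord : #|{: {perm 'I_b}}| = b`!.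
Proof. exact: card_Sn. Qed.

Lemma perm_frac_ge0 S : 0 <= perm_frac R S.
Proof. by rewrite divr_ge0 ?ler0n. Qed.

Lemma perm_fracT : perm_frac R [set: {perm 'I_b}]%SET = 1.
Proof. by rewrite /perm_frac cardsT card_perm_ord divff ?gt_eqF. Qed.

Lemma perm_fracS S S' : S \subset S' -> perm_frac R S <= perm_frac R S'.
Proof. by move=> SS'; rewrite ler_pM2r ?invr_gt0 // ler_nat subset_leq_card. Qed.

Lemma perm_frac_ge S n : (0 < n)%N -> (b`! <= n * #|S|)%N ->
  n%:R^-1 <= perm_frac R S.
Proof.
move=> n0 h; rewrite ler_pdivlMr // ler_pdivrMl ?ltr0n //.
by rewrite -natrM ler_nat.
Qed.

End PermFrac.

Section Steering.
Variables (b : nat) (lo one hi : 'I_b).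
Hypothesis lo_val : lo = 0%N :> nat.
Hypothesis one_val : one = 1%N :> nat.
Hypothesis hi_val : hi = b.-1 :> nat.

Definition scrambled_digits (p : seq 'I_b -> {perm 'I_b}) (f : nat -> 'I_b) :=
  fun r => p (mkseq f r) (f r).

(** Conditions on the permutation at prefix [w] that together bring the
    scrambled [f] and [g] within about [b ^- L] of each other: at their first
    differing digit send [f] to 0 and [g] to 1, and afterwards send the digits
    of [f] to [b - 1] and those of [g] to 0, so that [f] ends just below, and
    [g] just above, a common point. *)
Definition steer (f g : nat -> 'I_b) (L : nat) (w : seq 'I_b) : {set {perm 'I_b}} :=
  let i := size w in
  if (L <= i)%N then [set: {perm 'I_b}]%SET
  else if (w == mkseq f i) && (w == mkseq g i) then
    if f i == g i then [set: {perm 'I_b}]%SET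
    else [set s : {perm 'I_b} | (s (f i) == lo) && (s (g i) == one)]%SET
  else if w == mkseq f i then [set s : {perm 'I_b} | s (f i) == hi]%SET
  else if w == mkseq g i then [set s : {perm 'I_b} | s (g i) == lo]%SET
  else [set: {perm 'I_b}]%SET.

(** The gap between the two prefixes, counted in units of the last digit, stays
    at most one: [b + 0 - (b - 1) = 1]. *)
Lemma steer_prefix_int f g L p :
  (forall w, (size w < L)%N -> p w \in steer f g L w) ->
  forall i, (i <= L)%N ->
    prefix_int (scrambled_digits p g) i =
    (prefix_int (scrambled_digits p f) i + (mkseq f i != mkseq g i))%N.
Proof.
move=> pS; elim=> [//|i IH] iL.
have := pS (mkseq f i); have := pS (mkseq g i).
rewrite /= (IH (ltnW iL)) /scrambled_digits /steer !size_mkseq iL => /(_ isT) pg /(_ isT).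
move: pg; rewrite leqNgt iL /= !eqxx !mkseqS eqseq_rcons andbT.
have [fg|fg] /= := eqVneq (mkseq f i) (mkseq g i).
  have [-> _ _|fgi] := eqVneq (f i) (g i); first by rewrite addn0 addn0 fg.
  rewrite !inE fg => _ /andP[/eqP-> /eqP->].
  by rewrite lo_val one_val !addn0.
rewrite !inE => /eqP-> /eqP->.
rewrite lo_val hi_val mulnDl mul1n !addn0 -addnA.
by rewrite addn1 prednK // (leq_ltn_trans (leq0n _) (ltn_ord lo)).
Qed.

Lemma steer_close (R : realType) f g L p :
  (forall w, (size w < L)%N -> p w \in steer f g L w) ->
  `|digits_value R (scrambled_digits p f) - digits_value R (scrambled_digits p g)|
    <= 2 / b%:R ^+ L.
Proof.
move=> /steer_prefix_int/(_ L (leqnn L)) fg.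
have b0 : 0 < b%:R ^+ L :> R by rewrite exprn_gt0 // (digit_base_gt0 _ f).
have := digits_value_ge R (scrambled_digits p f) L.
have := digits_value_le R (scrambled_digits p f) L.
have := digits_value_ge R (scrambled_digits p g) L.
have := digits_value_le R (scrambled_digits p g) L.
rewrite fg; set A := prefix_int _ _.
move: (digits_value _ _) (digits_value _ _) => u v.
have B0 : 0 < (b%:R ^+ L)^-1 :> R by rewrite invr_gt0.
set B := (_ ^-1) in B0 *.
case: (_ != _) => /=; rewrite ?addn0 ?addn1 -!natr1 !mulrDl !mul1r => h1 h2 h3 h4;
  rewrite ler_norml; apply/andP; split; lra.
Qed.

(** Only permutations past the common prefix matter; this makes pairs with different
    prefixes independent. *)
Lemma steerT f g L k w : mkseq f k = mkseq g k -> take k w != mkseq f k ->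
  steer f g L w = [set: {perm 'I_b}]%SET.
Proof.
move=> fgk tw; rewrite /steer; case: ifP => // _.
have [kw|wk] := leqP k (size w).
  have nf h : mkseq h k = mkseq f k -> (w == mkseq h (size w)) = false.
    move=> hf; apply/negbTE; apply: contra tw => /eqP ->.
    by rewrite -hf /mkseq -map_take take_iota (minn_idPl kw).
  by rewrite !nf.
have fgw : mkseq f (size w).+1 = mkseq g (size w).+1 := mkseq_prefix wk fgk.
have /rcons_inj[-> ->] : rcons (mkseq f (size w)) (f (size w)) =
    rcons (mkseq g (size w)) (g (size w)) by rewrite -!mkseqS.
by rewrite andbb eqxx; case: eqP.
Qed.

Section SteeringProbability.
Variables (R : realType) (f g : nat -> 'I_b) (k L : nat).
Hypothesis fgk : mkseq f k = mkseq g k.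

Let on_path (h : nat -> 'I_b) (w : seq 'I_b) :=
  [&& (k <= size w)%N, (size w < L)%N & w == mkseq h (size w)].
Let cost h w : R := if on_path h w then b%:R^-1 else 1.

Let b0 : (0 < b)%N := leq_ltn_trans (leq0n _) (ltn_ord lo).

Let cost_ge0 h w : 0 <= cost h w.
Proof. by rewrite /cost; case: ifP. Qed.

(* A prefix lying on both paths has two digits to steer, and
   [(b - 2)! / b! >= b^-2]. *)
Let steer_frac_cost w : cost f w * cost g w <= perm_frac R (steer f g L w).
Proof.
have binv : (b%:R^-1 : R) <= 1 by rewrite invf_le1 ?ltr0n // ler1n.
have cost_le1 h : cost h w <= 1 by rewrite /cost; case: ifP.
have [wT|] := eqVneq (steer f g L w) [set: {perm 'I_b}]%SET.
  by rewrite wT perm_fracT mulr_ile1.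
rewrite /cost /on_path.
have [kw|wk] /= := leqP k (size w); last first.
  rewrite (@steerT f g L k) ?eqxx // take_oversize ?(ltnW wk) //.
  by apply: contraTneq wk => ->; rewrite size_mkseq ltnn.
rewrite /steer leqNgt; case: ltnP => //= _; last by rewrite eqxx.
have [wf|wf] /= := eqVneq w (mkseq f _); have [wg|wg] /= := eqVneq w (mkseq g _).
- have [fg|fg] := eqVneq (f _) (g _); first by rewrite eqxx.
  move=> _; rewrite -invfM -natrM mulnn perm_frac_ge ?expn_gt0 ?b0 //.
  have lo1 : lo != one by rewrite -val_eqE /= lo_val one_val.
  by have := card_perm_at2 fg lo1; rewrite card_perm_ord card_ord.
- move=> _; rewrite mulr1 perm_frac_ge //.
  by have := card_perm_at (f (size w)) hi; rewrite card_perm_ord card_ord.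
- move=> _; rewrite mul1r perm_frac_ge //.
  by have := card_perm_at (g (size w)) lo; rewrite card_perm_ord card_ord.
- by rewrite eqxx.
Qed.

Let prod_cost h : b%:R ^- (L - k) <= \prod_(w : {bseq L of 'I_b}) cost h w.
Proof.
rewrite /cost -big_mkcond /= prodr_const -exprVn.
apply: ler_wiXn2l; rewrite ?invr_ge0 ?ler0n // ?invf_le1 ?ltr0n ?ler1n //.
rewrite cardE -(size_map (fun w : {bseq L of 'I_b} => size w)) -[X in (_ <= X)%N](size_iota k).
apply: uniq_leq_size.
  rewrite map_inj_in_uniq ?enum_uniq // => v w; rewrite !mem_enum.
  move=> /and3P[_ _ /eqP vh] /and3P[_ _ /eqP wh] vw.
  by apply: val_inj; rewrite /= vh wh vw.
move=> _ /mapP[w + ->]; rewrite mem_enum mem_iota => /and3P[kw wL _].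
by rewrite kw /= subnKC // (leq_trans kw (ltnW wL)).
Qed.

(** Each of the [L - k] digits past the common prefix costs at most a factor [b]
    for [f] and a factor [b] for [g]. *)
Lemma prod_steer_frac :
  b%:R ^- (2 * (L - k)) <= \prod_(w : {bseq L of 'I_b}) perm_frac R (steer f g L w).
Proof.
apply: (@le_trans _ _ (\prod_(w : {bseq L of 'I_b}) (cost f w * cost g w))).
  rewrite big_split /= mul2n -addnn exprD invfM.
  by rewrite ler_pM ?invr_ge0 ?exprn_ge0 ?ler0n.
by apply: ler_prod => w _; rewrite steer_frac_cost mulr_ge0.
Qed.

End SteeringProbability.
End Steering.

(** * Second moments and independence *)

Section SecondMoment.
Context (R : realType) (disp : measure_display) (Omega : measurableType disp).
Variable P : probability Omega R.

Lemma integral_sum_indic (J : finType) (B : J -> set Omega) (c : J -> R) :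
  (forall j, measurable (B j)) -> (forall j, 0 <= c j) ->
  (\int[P]_o (\sum_j c j * \1_(B j) o)%:E = \sum_j (c j)%:E * P (B j))%E.
Proof.
move=> mB c0; under eq_integral do rewrite -sumEFin.
rewrite ge0_integral_sum //=.
- apply: eq_bigr => j _; under eq_integral do rewrite EFinM.
  rewrite ge0_integralZl_EFin //=; first by rewrite integral_indic ?setIT.
  by apply/measurable_EFinP; exact: measurable_indic.
- move=> j; apply/measurable_EFinP; apply: measurable_funM => //.
- by move=> j o _; rewrite lee_fin mulr_ge0.
Qed.

Lemma measurable_sum_indic (J : finType) (B : J -> set Omega) (c : J -> R) :
  (forall j, measurable (B j)) ->
  measurable_fun setT (fun o => \sum_j c j * \1_(B j) o).
Proof.
by move=> mB; apply: measurable_sum => j; apply: measurable_funM.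
Qed.

(** Let [X] be the sum of the indicators of the [A i], each divided by its
    probability, and [n] the number of events.  The mean of [X] is [n], and integrating
    [2 n X <= n^2 1_U + X^2], where [U] is the union, gives the bound.  The weights
    make the events count equally although their probabilities may differ. *)
Lemma second_moment (I : finType) (A : I -> set Omega) (p : I -> R) (g : I -> I -> R) :
  (0 < #|I|)%N -> (forall i, measurable (A i)) -> (forall i, 0 < p i) ->
  (forall i, P (A i) = (p i)%:E) ->
  (forall i j, (P (A i `&` A j) <= (p i * p j * g i j)%:E)%E) ->
  ((2 - (\sum_i \sum_j g i j) / #|I|%:R ^+ 2)%:E <= P (\bigcup_i A i))%E.
Proof.
move=> I0 mA p0 PA PAA.
set n : R := #|I|%:R; have n0 : 0 < n by rewrite ltr0n.
have mU : measurable (\bigcup_i A i).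
  by apply: fin_bigcup_measurable => [|i _] //; exact: finite_finset.
pose X o : R := \sum_i (p i)^-1 * \1_(A i) o.
have pV i : 0 <= (p i)^-1 by rewrite invr_ge0 ltW.
have XX o : X o ^+ 2 = \sum_(ij : I * I)
    ((p ij.1)^-1 * (p ij.2)^-1) * \1_(A ij.1 `&` A ij.2) o.
  rewrite expr2 /X big_distrl /= -(pair_bigA _ (fun i j => ((p i)^-1 * (p j)^-1) *
     \1_(A i `&` A j) o)) /=; apply: eq_bigr => i _.
  rewrite big_distrr /=; apply: eq_bigr => j _.
  by rewrite indicI /=; ring.
have mX : measurable_fun setT X by exact: measurable_sum_indic.
have X0 o : 0 <= X o by apply: sumr_ge0 => i _; rewrite mulr_ge0.
have le_int : (\int[P]_o (2 * n * X o)%:E <=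
    \int[P]_o ((n ^+ 2 * \1_(\bigcup_i A i) o)%:E + (X o ^+ 2)%:E))%E.
  apply: ge0_le_integral => //=.
  - by move=> o _; rewrite lee_fin !mulr_ge0 ?(ltW n0).
  - by apply/measurable_EFinP; apply: measurable_funM.
  - apply: emeasurable_funD; apply/measurable_EFinP; first exact: measurable_funM.
    exact: measurable_funX.
  - move=> o _; rewrite -EFinD lee_fin indicE.
    case: (boolP (o \in _)) => [_|/negP oU].
      rewrite mulr1 -subr_ge0 (_ : _ - _ = (n - X o) ^+ 2) ?sqr_ge0 //; ring.
    rewrite (_ : X o = 0) ?mulr0 ?expr0n ?addr0 //.
    rewrite /X big1 // => i _; rewrite indicE memNset ?mulr0 // => Ai.
    by apply: oU; rewrite inE; exists i.
have EX : (\int[P]_o (2 * n * X o)%:E = (2 * n ^+ 2)%:E)%E.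
  under eq_integral do rewrite EFinM.
  rewrite ge0_integralZl_EFin //=; last 3 first.
  - by move=> o _; rewrite lee_fin.
  - exact/measurable_EFinP.
  - by rewrite mulr_ge0 ?(ltW n0).
  rewrite integral_sum_indic //; under eq_bigr do rewrite PA -EFinM mulVf ?gt_eqF //.
  rewrite sumEFin sumr_const -[#|_|]/(#|I|) -EFinM -/n; congr EFin.
  by rewrite expr2 mulrA.
move: le_int; rewrite EX ge0_integralD //=; last 4 first.
- by move=> o _; rewrite lee_fin mulr_ge0 ?sqr_ge0.
- by apply/measurable_EFinP; exact: measurable_funM.
- by move=> o _; rewrite lee_fin sqr_ge0.
- by apply/measurable_EFinP; exact: measurable_funX.
under eq_integral do rewrite EFinM.
rewrite ge0_integralZl_EFin //=; last 2 first.
- by apply/measurable_EFinP; exact: measurable_indic.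
- exact: sqr_ge0.
rewrite integral_indic // setIT.
under [X in (_ + X)%E]eq_integral do rewrite XX.
rewrite integral_sum_indic; last 2 first.
- by move=> ij; exact: measurableI.
- by move=> ij; rewrite mulr_ge0.
have [u PU] : exists u, P (\bigcup_i A i) = u%:E.
  by exists (fine (P (\bigcup_i A i))); rewrite fineK // fin_num_measure.
rewrite [X in (_ * X)%E]PU PU.
have sum_le : (\sum_(ij : I * I) ((p ij.1)^-1 * (p ij.2)^-1)%:E *
    P (A ij.1 `&` A ij.2) <= (\sum_i \sum_j g i j)%:E)%E.
  rewrite pair_bigA /= -sumEFin; apply: lee_sum => -[i j] _ /=.
  apply: (@le_trans _ _ (((p i)^-1 * (p j)^-1)%:E * (p i * p j * g i j)%:E)%E).
    by rewrite lee_pmul2l // lte_fin mulr_gt0 ?invr_gt0.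
  by rewrite -EFinM lee_fin; have := p0 i; have := p0 j => pj pi;
    rewrite le_eqVlt; apply/orP; left; apply/eqP; field; rewrite !gt_eqF.
move=> /le_trans/(_ (leeD (lexx _) sum_le)).
rewrite -EFinM -EFinD !lee_fin => h.
rewrite lerBlDr -lerBlDl ler_pdivlMr ?exprn_gt0 //.
by rewrite mulrBl lerBlDl (mulrC u).
Qed.

End SecondMoment.

Section OwenProbability.
Context (R : realType) (b d : nat) (disp : measure_display).
Context (Omega : measurableType disp) (P : probability Omega R).
Variable pi : 'I_d -> seq 'I_b -> Omega -> {perm 'I_b}.
Hypothesis owen : owen_permutations P pi.

Lemma measurable_perm j w (S : {set {perm 'I_b}}) :
  measurable [set o | pi j w o \in S].
Proof.
have [mpi _ _] := owen.
rewrite (_ : [set o | _] = \bigcup_(s in [set` S]) [set o | pi j w o = s]).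
  by apply: fin_bigcup_measurable => // s _; exact: mpi.
apply/seteqP; split => [x xS|x [s sS /= ->]] //=.
by exists (pi j w x).
Qed.

Lemma prob_perm j w (S : {set {perm 'I_b}}) :
  P [set o | pi j w o \in S] = (perm_frac R S)%:E.
Proof.
have [mpi Ppi _] := owen.
rewrite (_ : [set o | _] = \bigcup_(s in [set` S]) [set o | pi j w o = s]); last first.
  apply/seteqP; split => [x xS|x [s sS /= ->]] //=.
  by exists (pi j w x).
have -> : [set` S] = [set` enum S] by apply/seteqP; split=> s /=; rewrite mem_enum.
rewrite measure_fin_bigcup //=; last by move=> s t _ _ [x [/= <- <-]].
rewrite -fsbig_seq ?enum_uniq // big_enum /=; under eq_bigr do rewrite Ppi.
by rewrite sumEFin sumr_const /perm_frac mulr_natl.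
Qed.

Section Box.
Variables (L : nat) (S : 'I_d -> seq 'I_b -> {set {perm 'I_b}}).

(** Only finitely many permutations are constrained, so that their mutual
    independence turns the probability into a product. *)
Definition perm_box : set Omega :=
  [set o | forall j (w : seq 'I_b), (size w <= L)%N -> pi j w o \in S j w].

Let keys : seq ('I_d * seq 'I_b) :=
  [seq (jw.1, val jw.2) | jw <- enum {: 'I_d * {bseq L of 'I_b}}].

Let uniq_keys : uniq keys.
Proof.
by rewrite map_inj_uniq ?enum_uniq // => -[j v] [j' w] /= [-> /val_inj->].
Qed.

Let perm_boxE : perm_box =
  \bigcap_(i in [set` keys]) [set o | pi i.1 i.2 o \in S i.1 i.2].
Proof.
apply/seteqP; split => [x h _ /mapP[[j w] _ ->] /=|x h j w wL].
  by apply: h; exact: size_bseq.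
apply: (h (j, w)); apply/mapP; exists (j, Bseq wL) => //.
by rewrite mem_enum.
Qed.

Lemma measurable_perm_box : measurable perm_box.
Proof.
by rewrite perm_boxE; apply: fin_bigcap_measurable => // i _; exact: measurable_perm.
Qed.

Lemma prob_perm_box :
  P perm_box = (\prod_(j < d) \prod_(w : {bseq L of 'I_b}) perm_frac R (S j w))%:E.
Proof.
have [_ _ indep] := owen.
rewrite perm_boxE (indep keys (fun i => S i.1 i.2)) //.
under eq_bigr do rewrite prob_perm.
rewrite prodEFin big_map big_enum /=; congr EFin.
by rewrite pair_bigA.
Qed.

End Box.

Lemma perm_boxI L S S' :
  perm_box L S `&` perm_box L S' = perm_box L (fun j w => S j w :&: S' j w)%SET.
Proof.
apply/seteqP; split => [x [h h'] j w wL|x h].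
  by rewrite finset.in_setI h ?h'.
by split=> j w wL; have := h j w wL; rewrite finset.in_setI => /andP[].
Qed.

End OwenProbability.

(** * Pairs of points with a common digit prefix *)

Section NetPairs.
Context (R : realType) (b d t m k : nat).
Hypotheses (d_gt0 : (0 < d)%N) (b_gt1 : (1 < b)%N) (m_ge : (d * k + (t + d.+1) <= m)%N).
Variables (x : 'I_(b ^ m) -> 'rV[R]_d) (e : 'I_(b ^ m) -> 'I_d -> nat -> 'I_b).
Hypotheses (net : is_net t x) (digits : are_digits x e).

Let b0 : 0 < b%:R :> R. Proof. by rewrite ltr0n (ltn_trans _ b_gt1). Qed.

(** A coordinate in an interval of length [b ^- k] determines its first [k] digits
    only up to one alternative, an expansion ending in digits [b - 1] having the
    prefix of the interval to the left. *)
Lemma prefix_int_of_interval n j a :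
  a%:R / b%:R ^+ k <= x n 0 j < a.+1%:R / b%:R ^+ k ->
  (prefix_int (e n j) k <= a <= (prefix_int (e n j) k).+1)%N.
Proof.
have bk : 0 < b%:R ^+ k :> R by rewrite exprn_gt0.
rewrite -digits => /andP[ax xa]; apply/andP; split.
  have := le_lt_trans (digits_value_ge R (e n j) k) xa.
  by rewrite ltr_pM2r ?invr_gt0 // ltr_nat ltnS.
have := le_trans ax (digits_value_le R (e n j) k).
by rewrite ler_pM2r ?invr_gt0 // ler_nat.
Qed.

Variable i : {ffun 'I_d -> 'I_(b ^ k)}.

Let l := (m - t - d * k)%N.

(** The box [i] splits along one coordinate into [b ^ l] elementary intervals of
    the volume at which the net property applies, so it has [b ^ l] points at least. *)
Let slab_point (c : 'I_(b ^ l)) : exists n : 'I_(b ^ m),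
  (forall j, (i j)%:R / b%:R ^+ k <= x n 0 j < (i j).+1%:R / b%:R ^+ k) /\
  (i (Ordinal d_gt0) * b ^ l + c)%:R / b%:R ^+ (k + l) <= x n 0 (Ordinal d_gt0)
    < (i (Ordinal d_gt0) * b ^ l + c).+1%:R / b%:R ^+ (k + l).
Proof.
set j0 := Ordinal d_gt0.
have [_ _ count] := net.
pose kk (j : 'I_d) := if j == j0 then (k + l)%N else k.
pose aa (j : 'I_d) : nat := if j == j0 then (i j * b ^ l + c)%N else i j.
have aa_lt j : (aa j < b ^ kk j)%N.
  rewrite /aa /kk; case: eqP => // _; rewrite expnD.
  apply: (@leq_trans ((i j).+1 * b ^ l)%N); last by rewrite leq_mul2r ltn_ord orbT.
  by rewrite mulSn addnC ltn_add2r.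
have vol : \prod_(j < d) (b%:R ^+ kk j)^-1 = b%:R ^+ t / b%:R ^+ m :> R.
  have mE : m = (d * k + l + t)%N by rewrite /l; lia.
  rewrite (bigD1 j0) //= /kk eqxx.
  rewrite (eq_bigr (fun=> (b%:R ^+ k)^-1)) => [|j /negbTE->//].
  rewrite prodr_const cardC1 card_ord -!exprVn -exprM -exprD mE.
  rewrite [in RHS](exprD _ (d * k + l)) mulrCA -exprMn divff ?gt_eqF //.
  rewrite expr1n mulr1; congr (_ ^+ _).
  by rewrite -[in RHS](prednK d_gt0) mulSn mulnC; lia.
have /card_gt0P[n] : (0 < #|[pred n | x n \in elementary_interval b kk aa]|)%N.
  by rewrite count // expn_gt0 (ltn_trans _ b_gt1).
rewrite !inE /elementary_interval /= => xn; exists n; split; last first.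
  by have := xn j0; rewrite /aa /kk eqxx.
have refine a : a%:R / b%:R ^+ k = (a * b ^ l)%N%:R / b%:R ^+ (k + l) :> R.
  by rewrite natrM natrX exprD -mulf_div divff ?mulr1 // expf_neq0 ?gt_eqF.
have bkl : 0 < (b%:R ^+ (k + l))^-1 :> R by rewrite invr_gt0 exprn_gt0.
move=> j; have := xn j; rewrite /aa /kk; case: eqP => // _ /andP[xge xlt].
rewrite !refine; apply/andP; split.
  by apply: le_trans xge; rewrite ler_pM2r // ler_nat leq_addr.
apply: (lt_le_trans xlt); rewrite ler_pM2r // ler_nat.
by rewrite mulSn addnC ltn_add2r.
Qed.

(** More than [2^d] points of the box compete for [2^d] digit prefixes. *)
Lemma net_close_pair : exists uv : 'I_(b ^ m) * 'I_(b ^ m),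
  [/\ uv.1 != uv.2, forall j, mkseq (e uv.1 j) k = mkseq (e uv.2 j) k &
      forall j, (prefix_int (e uv.1 j) k <= i j <= (prefix_int (e uv.1 j) k).+1)%N].
Proof.
have [n xn] := choice slab_point.
have prefix_n c j := prefix_int_of_interval (proj1 (xn c) j).
have n_inj : injective n.
  move=> c c' ncc'; apply: val_inj; have [_ /=] := xn c; have [_ /=] := xn c'.
  rewrite ncc'; set y := x _ _ _; set A := (_ * _)%N => /andP[h1 h2] /andP[h3 h4].
  have bkl : 0 < (b%:R ^+ (k + l))^-1 :> R by rewrite invr_gt0 exprn_gt0.
  have := le_lt_trans h1 h4; have := le_lt_trans h3 h2.
  rewrite !ltr_pM2r // !ltr_nat; lia.
pose shift c := [ffun j => prefix_int (e (n c) j) k == i j].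
have /injectivePn[c [c' cc' /ffunP shift_cc']] : ~~ injectiveb shift.
  apply/injectiveP => /leq_card; rewrite card_ffun !card_ord card_bool.
  apply/negP; rewrite -ltnNge (@leq_trans (2 ^ l)%N) //.
    by rewrite ltn_exp2l // /l; lia.
  by rewrite leq_exp2r // /l; lia.
exists (n c, n c'); split => //= [|j]; first by rewrite (inj_eq n_inj).
apply: prefix_int_inj; have := prefix_n c j; have := prefix_n c' j.
by have := shift_cc' j; rewrite !ffunE; lia.
Qed.

End NetPairs.

(** * Some box is steered *)

(** Points of two boxes can have the same digit prefix in a coordinate only if the
    boxes are equal or adjacent there. *)
Definition adjacent (a a' : nat) : bool := (a <= a'.+1)%N && (a' <= a.+1)%N.

Lemma card_adjacent K (a : nat) : (#|[set a' : 'I_K | adjacent a a']%SET| <= 3)%N.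
Proof.
rewrite cardE -(size_map val) (@uniq_leq_size _ _ [:: a.-1; a; a.+1]) //.
  by rewrite map_inj_uniq ?enum_uniq //; exact: val_inj.
move=> _ /mapP[x + ->]; rewrite mem_enum inE /adjacent !inE => /andP[/= h1 h2].
lia.
Qed.

Lemma norm_row_le (R : realType) d (x : 'rV[R]_d) (c : R) : 0 <= c ->
  (forall j, `|x 0 j| <= c) -> `|x| <= c.
Proof.
move=> c0 xc; rewrite [leLHS]/Num.norm /= mx_normrE; apply: bigmax_le => // -[i j] _ /=.
by rewrite ord1.
Qed.

Lemma separation_le (R : realType) d N (x : 'I_N -> 'rV[R]_d) n n' : n != n' ->
  separation x <= `|x n - x n'|.
Proof.
wlog : n n' / (n < n')%N => [h nn'|nn' _].
  have := nn'; rewrite -val_eqE /= neq_ltn => /orP[|] lt_nn'; first exact: h.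
  by rewrite distrC h // eq_sym.
apply: ge_inf; last by exists (n, n').
by exists 0 => _ [p _ <-].
Qed.

Lemma separation_ge0 (R : realType) d N (x : 'I_N -> 'rV[R]_d) : (1 < N)%N ->
  0 <= separation x.
Proof.
move=> N1; apply: lb_le_inf => [|_ [p _ <-] //].
exists `|x (Ordinal (ltnW N1)) - x (Ordinal N1)|.
by exists (Ordinal (ltnW N1), Ordinal N1).
Qed.

Section ClosePairs.
Context (R : realType) (b d k s : nat) (disp : measure_display).
Context (Omega : measurableType disp) (P : probability Omega R).
Variable pi : 'I_d -> seq 'I_b -> Omega -> {perm 'I_b}.
Hypothesis owen : owen_permutations P pi.
Variables lo one hi : 'I_b.
Hypothesis lo_val : lo = 0%N :> nat.
Hypothesis one_val : one = 1%N :> nat.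
Hypothesis hi_val : hi = b.-1 :> nat.

Let I := {ffun 'I_d -> 'I_(b ^ k)}.
Variables f g : I -> 'I_d -> nat -> 'I_b.
Hypothesis fg_prefix : forall i j, mkseq (f i j) k = mkseq (g i j) k.
Hypothesis f_box : forall i j,
  (prefix_int (f i j) k <= i j <= (prefix_int (f i j) k).+1)%N.

Let S i j := steer lo one hi (f i j) (g i j) (k + s).

Definition steered_box (i : I) : set Omega := perm_box pi (k + s) (S i).

Let b0 : 0 < b%:R :> R.
Proof. by rewrite ltr0n (leq_ltn_trans (leq0n _) (ltn_ord lo)). Qed.

Let weight (a a' : nat) : R := if adjacent a a' then b%:R ^+ (2 * s) else 1.

Let pr i j : R := \prod_(w : {bseq (k + s) of 'I_b}) perm_frac R (S i j w).

Let pr_ge i j : b%:R ^- (2 * s) <= pr i j.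
Proof.
have := prod_steer_frac hi lo_val one_val R (k + s) (fg_prefix i j).
by rewrite addKn.
Qed.

Let pr_gt0 i j : 0 < pr i j.
Proof. by apply: lt_le_trans (pr_ge i j); rewrite invr_gt0 exprn_gt0. Qed.

(** Different permutations are independent, so two boxes interact only in the
    coordinates in which they are adjacent, and there at most by the full
    probability of one of them. *)
Let prI i i' j :
  \prod_(w : {bseq (k + s) of 'I_b}) perm_frac R (S i j w :&: S i' j w)%SET <=
  pr i j * pr i' j * weight (i j) (i' j).
Proof.
rewrite /weight; case: ifP => [_|not_adj].
  apply: (@le_trans _ _ (pr i j)).
    apply: ler_prod => w _; rewrite perm_frac_ge0 perm_fracS //.
    exact: finset.subsetIl.
  rewrite -mulrA ler_peMr ?(ltW (pr_gt0 _ _)) //.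
  by rewrite -ler_pdivrMr ?exprn_gt0 // div1r.
rewrite mulr1 /pr -big_split /=; apply: ler_prod => w _.
rewrite perm_frac_ge0 /=.
have [tw|tw] := eqVneq (take k w) (mkseq (f i j) k); last first.
  by rewrite /S (steerT lo one hi _ (fg_prefix i j) tw) finset.setTI perm_fracT mul1r.
have tw' : take k w != mkseq (f i' j) k.
  apply/eqP => tw'; move/negP: not_adj; apply.
  have := f_box i j; have := f_box i' j.
  rewrite (eq_prefix_int (etrans (esym tw) tw')) /adjacent; lia.
by rewrite /S (steerT lo one hi _ (fg_prefix i' j) tw') finset.setIT perm_fracT mulr1.
Qed.

Let sum_weight (a : nat) :
  \sum_(a' < b ^ k) weight a a' <= (b ^ k)%:R + 3 * b%:R ^+ (2 * s).
Proof.
apply: (@le_trans _ _ (\sum_(a' < b ^ k) (1 + (adjacent a a')%:R * b%:R ^+ (2 * s)))).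
  apply: ler_sum => a' _; rewrite /weight; case: ifP => _.
    by rewrite mul1r lerDr.
  by rewrite mul0r addr0.
rewrite big_split /= sumr_const card_ord lerD2l -big_distrl /=.
rewrite ler_wpM2r ?exprn_ge0 ?(ltW b0) //.
rewrite -natr_sum ler_nat (leq_trans _ (card_adjacent (b ^ k) a)) //.
rewrite -sum1dep_card [leqRHS]big_mkcond /=; apply: leq_sum => a' _.
by case: adjacent.
Qed.

(** The weights of the pairs of boxes factor over the coordinates: their sum is at most
    the [d]-th power of [b^k (b^k + 3 b^(2s))], against the square of the number [b^(kd)]
    of boxes. *)
Lemma prob_some_steered :
  ((2 - (1 + 3 * b%:R ^+ (2 * s) / b%:R ^+ k) ^+ d)%:E <=
    P (\bigcup_i steered_box i))%E.
Proof.
pose p i := \prod_(j < d) pr i j.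
pose G (i i' : I) := \prod_(j < d) weight (i j) (i' j).
have Kd : #|{: I}|%:R = (b%:R ^+ k) ^+ d :> R.
  by rewrite card_ffun !card_ord natrX natrX.
have K0 : 0 < b%:R ^+ k :> R by rewrite exprn_gt0.
apply: le_trans (second_moment (p := p) (g := G) _ _ _ _ _); last first.
- move=> i i'; rewrite perm_boxI (prob_perm_box owen) lee_fin -!big_split /=.
  apply: ler_prod => j _; rewrite prI andbT.
  by apply: prodr_ge0 => w _; exact: perm_frac_ge0.
- by move=> i; rewrite (prob_perm_box owen).
- by move=> i; apply: prodr_gt0 => j _.
- by move=> i; exact: (measurable_perm_box owen).
- by rewrite -(ltr0n R) Kd exprn_gt0.
rewrite lee_fin lerB // Kd ler_pdivrMr ?exprn_gt0 //.
(* expand the sum over [i'] of a product over the coordinates *)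
have rowG i : \sum_i' G i i' <= ((b ^ k)%:R + 3 * b%:R ^+ (2 * s)) ^+ d.
  rewrite /G -(bigA_distr_bigA (fun j (a' : 'I_(b ^ k)) => weight (i j) a')) /=.
  rewrite -[X in _ <= _ ^+ X]card_ord -prodr_const; apply: ler_prod => j _.
  by rewrite sum_weight sumr_ge0 // => a' _; rewrite /weight; case: ifP;
    rewrite ?exprn_ge0 ?(ltW b0).
apply: (le_trans (ler_sum _ (fun i _ => rowG i))).
rewrite sumr_const -[leLHS]mulr_natl [X in X * _ <= _]Kd natrX.
rewrite expr2 mulrA [leRHS]mulrC ler_pM2l ?exprn_gt0 // -exprMn.
by rewrite [in leRHS]mulrDl mul1r divfK ?gt_eqF.
Qed.

Lemma measurable_some_steered : measurable (\bigcup_i steered_box i).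
Proof.
apply: fin_bigcup_measurable => [|i _]; first exact: finite_finset.
exact: (measurable_perm_box owen).
Qed.

End ClosePairs.

(** * Fill distance and measurability *)

Section NearestPoint.
Context (R : realType) (d N : nat) (x : 'I_N -> 'rV[R]_d).

(** The function maximized over the cube by the fill distance. *)
Definition nearest_dist (z : 'rV[R]_d) : R := inf [set `|z - x n| | n in setT].

Lemma nearest_dist_le z n : nearest_dist z <= `|z - x n|.
Proof. by apply: ge_inf; [exists 0 => _ [i _ <-] | exists n]. Qed.

Lemma nearest_dist_ge z c : (0 < N)%N -> (forall n, c <= `|z - x n|) ->
  c <= nearest_dist z.
Proof.
move=> N0 cz; apply: lb_le_inf => [|_ [n _ <-] //].
by exists `|z - x (Ordinal N0)|; exists (Ordinal N0).
Qed.

Lemma nearest_dist_lipschitz z z' : (0 < N)%N ->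
  nearest_dist z - `|z - z'| <= nearest_dist z'.
Proof.
move=> N0; apply: nearest_dist_ge => // n; rewrite lerBlDl.
apply: (le_trans (nearest_dist_le z n)).
by rewrite (le_trans _ (ler_normD _ _)) // addrA subrK.
Qed.

Lemma nearest_dist_le_fill z : (0 < N)%N -> cube z ->
  nearest_dist z <= fill_distance x.
Proof.
move=> N0 zc; apply: ub_le_sup; last by exists z.
exists (1 + `|x (Ordinal N0)|) => _ [y yc <-].
apply: (le_trans (nearest_dist_le y (Ordinal N0))).
rewrite (le_trans (ler_normB _ _)) // lerD2r norm_row_le // => j.
by have /andP[y0 y1] := yc j; rewrite ger0_norm.
Qed.

Lemma coord_le_norm (y : 'rV[R]_d) j : `|y 0 j| <= `|y|.
Proof.
rewrite [leRHS]/Num.norm /= mx_normrE.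
by apply: (@le_bigmax _ _ _ 0 (fun i : 'I_1 * 'I_d => `|y i.1 i.2|) (0, j)).
Qed.

(** With more grid cells than points some cell is empty, and its centre is at
    least half a cell away from every point. *)
Lemma fill_distance_ge G : (0 < N)%N -> (0 < G)%N -> (N < G ^ d)%N ->
  (2 * G%:R)^-1 <= fill_distance x.
Proof.
move=> N0; case: G => // G _ NG.
have G0 : 0 < G.+1%:R :> R by rewrite ltr0n.
pose cell n : {ffun 'I_d -> 'I_G.+1} :=
  [ffun j => inord (Num.truncn (G.+1%:R * x n 0 j))].
have [a a_empty] : exists a, a \notin codom cell.
  apply/existsP; rewrite -negb_forall; apply: contraL NG => /forallP all_hit.
  rewrite -leqNgt; have /subset_leq_card : {: {ffun 'I_d -> 'I_G.+1}} \subset codom cell.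
    by apply/fintype.subsetP => a _; exact: all_hit.
  by rewrite card_ffun !card_ord => /leq_trans; apply;
    rewrite (leq_trans (card_size _)) // size_codom card_ord.
pose z : 'rV[R]_d := \row_j (((a j)%:R + 2^-1) / G.+1%:R).
have zc : cube z.
  move=> j; rewrite mxE divr_ge0 ?addr_ge0 ?ler0n ?invr_ge0 //=.
  rewrite ler_pdivrMr // mul1r; have := ltn_ord (a j); rewrite -(ler_nat R) -natr1 => h.
  lra.
apply: le_trans (nearest_dist_le_fill N0 zc); apply: nearest_dist_ge => // n.
rewrite leNgt; apply: contra a_empty => zx.
suff -> : a = cell n by exact: codom_f.
apply/ffunP => j; rewrite ffunE; apply: val_inj.
have := le_lt_trans (coord_le_norm (z - x n) j) zx.
rewrite invfM -[X in X < _](@mulfK _ G.+1%:R) ?gt_eqF //.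
rewrite ltr_pM2r ?invr_gt0 // -[X in _ * X](gtr0_norm G0) -normrM !mxE mulrBl.
rewrite divfK ?gt_eqF // ltr_norml mulrC => /andP[h1 h2].
rewrite (@truncn_def _ _ (a j)) ?inord_val //.
by apply/andP; split; rewrite -?natr1 mulrC; lra.
Qed.

End NearestPoint.

Section Measurability.
Context (R : realType) (d N : nat) (disp : measure_display).
Context (Omega : measurableType disp).

Lemma measurable_row_norm (y : Omega -> 'rV[R]_d) :
  (forall j, measurable_fun setT (fun o => y o 0 j)) ->
  measurable_fun setT (fun o => `|y o|).
Proof.
move=> my.
rewrite (_ : (fun o => _) = fun o => \big[Num.max/0]_(ij : 'I_1 * 'I_d) `|y o ij.1 ij.2|).
  elim: (index_enum _) => [|[i j] r IH].
    by under eq_fun do rewrite big_nil; exact: measurable_cst.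
  under eq_fun do rewrite big_cons.
  by apply: measurable_maxr => //=; apply: measurableT_comp => //; rewrite ord1; exact: my.
by apply/funext => o; rewrite [LHS]/Num.norm /= mx_normrE.
Qed.

Lemma measurable_inf_countable (J : Type) (D : set J) (h : J -> Omega -> R) :
  countable [set: J] -> D !=set0 -> (forall j o, 0 <= h j o) ->
  (forall j, measurable_fun setT (h j)) ->
  measurable_fun setT (fun o => inf [set h j o | j in D]).
Proof.
move=> cJ [j0 Dj0] h0 mh.
apply: (measurability _ (RGenInftyO.measurableE R)) => //.
move=> _ [_ [r ->] <-]; rewrite setTI.
rewrite (_ : _ @^-1` _ = \bigcup_j (if `[< D j >] then h j @^-1` `]-oo, r[ else set0)).
  apply: countable_bigcupT_measurable => // j; case: asboolP => // _.
  by rewrite -[X in measurable X]setTI; apply: mh => //; exact: measurable_itv.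
apply/seteqP; split => [x|x [j _]]; rewrite /= in_itv /=.
  move/inf_lt => []; first by exists (h j0 x); exists j0.
  by move=> _ [j Dj <-] hr; exists j => //; rewrite asboolT //= in_itv.
case: asboolP => // Dj; rewrite /= in_itv /=; apply: le_lt_trans.
by apply: ge_inf; [exists 0 => _ [i _ <-] | exists j].
Qed.

Lemma rat_near_unit (z eps : R) : 0 <= z <= 1 -> 0 < eps ->
  exists q : rat, 0 <= (ratr q : R) <= 1 /\ `|z - ratr q| <= eps.
Proof.
move=> /andP[z0 z1] eps0.
have [|q] := @rat_in_itvoo R (Num.max 0 (z - eps)) (Num.min 1 (z + eps)).
  by rewrite gt_max !lt_min; apply/andP; split; apply/andP; split; lra.
rewrite in_itv /= gt_max lt_min => /andP[/andP[q0 qz] /andP[q1 zq]].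
exists q; split; first by rewrite !ltW.
by rewrite ler_norml; apply/andP; split; lra.
Qed.

Variable X : Omega -> 'I_N -> 'rV[R]_d.
Hypothesis mX : forall n j, measurable_fun setT (fun o => X o n 0 j).
Hypothesis N_gt1 : (1 < N)%N.

Lemma measurable_separation : measurable_fun setT (fun o => separation (X o)).
Proof.
apply: measurable_inf_countable => //.
  by exists (Ordinal (ltnW N_gt1), Ordinal N_gt1).
move=> p; apply: measurable_row_norm => j.
under eq_fun do rewrite !mxE.
by apply: measurable_funB.
Qed.

Lemma measurable_nearest_dist z : measurable_fun setT (fun o => nearest_dist (X o) z).
Proof.
apply: measurable_inf_countable => //.
  by exists (Ordinal N_gt1).
move=> p; apply: measurable_row_norm => j.
under eq_fun do rewrite !mxE.
by apply: measurable_funB.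
Qed.

(** The distance to the nearest point being continuous, rational points of the
    cube suffice, and a supremum over countably many of them is measurable. *)
Lemma measurable_fill_distance : measurable_fun setT (fun o => fill_distance (X o)).
Proof.
have N0 := ltnW N_gt1.
apply: (measurability _ (RGenOInfty.measurableE R)) => //.
move=> _ [_ [r ->] <-]; rewrite setTI.
pose zq (q : 'rV[rat]_d) : 'rV[R]_d := map_mx ratr q.
rewrite (_ : _ @^-1` _ = \bigcup_(q : 'rV[rat]_d)
    (if `[< cube (zq q) >] then (fun o => nearest_dist (X o) (zq q)) @^-1` `]r, +oo[
     else set0)).
  apply: countable_bigcupT_measurable => // q.
  case: asboolP => // _; rewrite -[X in measurable X]setTI.
  by apply: measurable_nearest_dist => //; exact: measurable_itv.
apply/seteqP; split => [x|x [q _]]; rewrite /= in_itv /= andbT.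
  move/sup_gt => [].
    by exists (nearest_dist (X x) 0); exists 0 => // j; rewrite mxE lexx ler01.
  move=> _ [z zc <-] rz; rewrite -/(nearest_dist (X x) z) in rz.
  have eps0 : 0 < (nearest_dist (X x) z - r) / 2 by rewrite divr_gt0 // subr_gt0.
  have [q qz] := choice (fun j => rat_near_unit (zc j) eps0).
  exists (\row_j q j) => //; rewrite asboolT => [|j]; last by rewrite !mxE; case: (qz j).
  rewrite /= in_itv /= andbT; apply: lt_le_trans (nearest_dist_lipschitz _ z _ N0).
  have : `|z - zq (\row_j q j)| <= (nearest_dist (X x) z - r) / 2.
    by apply: norm_row_le => [|j]; rewrite ?(ltW eps0) // !mxE; case: (qz j).
  lra.
case: asboolP => // qc; rewrite /= in_itv /= andbT => /lt_le_trans; apply.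
exact: nearest_dist_le_fill.
Qed.

End Measurability.

(** * Nets of a fixed size *)

Section ScrambledCoordinates.
Context (R : realType) (b d N : nat) (disp : measure_display).
Context (Omega : measurableType disp) (P : probability Omega R).
Variables (pi : 'I_d -> seq 'I_b -> Omega -> {perm 'I_b}) (e : 'I_N -> 'I_d -> nat -> 'I_b).
Hypothesis owen : owen_permutations P pi.

Lemma measurable_scramble n j : measurable_fun setT (fun o => scramble R pi e o n 0 j).
Proof.
under eq_fun do rewrite mxE.
apply: (@measurable_fun_cvg _ _ R setT (fun l o =>
  series (fun r => (pi j (mkseq (e n j) r) o (e n j r))%:R / b%:R ^+ r.+1 : R) l)).
  move=> l; apply: measurable_sum => r; apply: measurable_funM => // _ Y _.
  rewrite setTI (_ : _ @^-1` _ = [set o | pi j (mkseq (e n j) r) o \in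
      [set s : {perm 'I_b} | `[< Y (s (e n j r))%:R >]]%SET]).
    exact: (measurable_perm owen).
  by apply/seteqP; split => o /=; rewrite inE => /asboolP.
by move=> o _; exact: is_cvg_series_digits.
Qed.

End ScrambledCoordinates.

Lemma exprD1_le (R : realType) (y : R) d : 0 <= y <= 1 ->
  (1 + y) ^+ d <= 1 + 2 ^+ d * y.
Proof.
move=> /andP[y0 y1].
suff : (1 + y) ^+ d <= 1 + (2 ^+ d - 1) * y by move=> /le_trans; apply; lra.
elim: d => [|d IH]; first by rewrite !expr0 subrr mul0r addr0.
have d1 : 1 <= 2 ^+ d :> R by rewrite exprn_ege1 // ler1n.
rewrite !exprS; apply: (@le_trans _ _ ((1 + y) * (1 + (2 ^+ d - 1) * y))).
  by rewrite ler_wpM2l // addr_ge0.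
move: d1; move: (2 ^+ d) => D d1; rewrite -subr_ge0.
have -> : 1 + (2 * D - 1) * y - (1 + y) * (1 + (D - 1) * y) =
  (D - 1) * y * (1 - y) by ring.
by rewrite !mulr_ge0 ?subr_ge0.
Qed.

Lemma exprn_bracket (R : realType) (b : nat) (z : R) : (1 < b)%N -> 1 <= z ->
  exists s, b%:R ^+ s <= z < b%:R ^+ s.+1.
Proof.
move=> b1 z1.
have ex : exists n, z < b%:R ^+ n.
  exists (Num.truncn z).+1; apply: (lt_le_trans (truncnS_gt z)).
  by rewrite -natrX ler_nat ltnW // ltn_expl.
case: (ex_minnP ex) => -[|s]; first by rewrite expr0 ltNge z1.
move=> zs min_s; exists s; rewrite zs andbT leNgt.
by apply/negP => /min_s; rewrite ltnn.
Qed.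

Lemma box_level_bounds d t m (k := ((m - (t + d.+1)) %/ d)%N) :
  (0 < d)%N -> (t + d.+1 <= m)%N ->
  (d * k + (t + d.+1) <= m <= d * k + (t + 2 * d + 1))%N.
Proof.
move=> d0 m_ge; have := ltn_ceil (m - (t + d.+1)) d0.
by have := leq_trunc_div (m - (t + d.+1)) d; rewrite -/k; lia.
Qed.

(** The factor [2^d * 3] comes from [prob_some_steered], the power of [b] bounds
    [N^(1/d) / b^k], and the last [b] is lost by rounding [s] to an integer.  The [c]
    of the theorem is the inverse of [b] times this constant. *)
Definition scrambling_constant (b d t : nat) : nat :=
  (2 ^ d * 3 * b ^ (t + 2 * d + 1) * b)%N.

Section FixedSize.
Context (R : realType) (b d t m : nat) (disp : measure_display).
Context (Omega : measurableType disp) (P : probability Omega R).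
Hypotheses (d_gt0 : (0 < d)%N) (b_gt1 : (1 < b)%N) (m_ge : (t + d.+1 <= m)%N).
Variables (x : 'I_(b ^ m) -> 'rV[R]_d) (e : 'I_(b ^ m) -> 'I_d -> nat -> 'I_b).
Variable pi : 'I_d -> seq 'I_b -> Omega -> {perm 'I_b}.
Hypotheses (net : is_net t x) (digits : are_digits x e) (owen : owen_permutations P pi).

Let b0 : 0 < b%:R :> R. Proof. by rewrite ltr0n (ltn_trans _ b_gt1). Qed.
Let b_ge1 : 1 <= b%:R :> R. Proof. by rewrite ler1n (ltn_trans _ b_gt1). Qed.

Let N_gt1 : (1 < b ^ m)%N.
Proof. by apply: leq_trans (ltn_expl _ b_gt1); lia. Qed.

Let xt o := scramble R pi e o.

Let m_xt n j : measurable_fun setT (fun o => xt o n 0 j).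
Proof. exact: (measurable_scramble e owen). Qed.

Lemma measurable_separation_le r : measurable [set o | separation (xt o) <= r].
Proof.
rewrite (_ : [set o | _] = (fun o => separation (xt o)) @^-1` `]-oo, r]).
  by rewrite -[X in measurable X]setTI; apply: (measurable_separation m_xt).
by apply/seteqP; split => o /=; rewrite in_itv.
Qed.

(** [nu] stands for [N^(1/(2d))] and [mu] for [lambda^(1/2)]. *)
Variable nu : R.
Hypotheses (nu_gt0 : 0 < nu) (nuX : nu ^+ (2 * d) = b%:R ^+ m).

Let C : R := (scrambling_constant b d t)%:R.

(** With [b^s] equal to [nu / mu] up to a factor [b], the steered pairs are at
    distance [2 b^(-k-s)], of order [mu / nu^3], and the probability that there is
    none is of order [b^(2s) / b^k], that is [mu^-2]. *)
Lemma prob_separation_le (mu : R) : 1 <= mu -> mu <= nu ->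
  ((1 - C / mu ^+ 2)%:E <= P [set o | (separation (xt o) <= C * mu / nu ^+ 3)%R])%E.
Proof.
move=> mu1 mu_nu; have mu0 : 0 < mu by apply: lt_le_trans mu1.
pose k := ((m - (t + d.+1)) %/ d)%N.
pose c1 : R := b%:R ^+ (t + 2 * d + 1).
have c1_ge1 : 1 <= c1 by rewrite exprn_ege1.
have c1_gt0 := lt_le_trans ltr01 c1_ge1.
have CE : C = 2 ^+ d * 3 * c1 * b%:R by rewrite /C !natrM !natrX.
have D1 : 1 <= 2 ^+ d :> R by rewrite exprn_ege1 // ler1n.
have /andP[k_le k_ge] := box_level_bounds d_gt0 m_ge; rewrite -/k in k_le k_ge.
have bk0 : 0 < b%:R ^+ k :> R by rewrite exprn_gt0.
(* the boxes have side of order N^(-1/d) *)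
have nu_bk : nu ^+ 2 <= b%:R ^+ k * c1.
  rewrite -(@ler_pXn2r _ d) // ?nnegrE ?mulr_ge0 ?(ltW bk0) ?(ltW c1_gt0)
    ?exprn_ge0 ?(ltW nu_gt0) //.
  rewrite -exprM nuX exprMn /c1 -!exprM -exprD.
  apply: ler_weXn2l => //; rewrite (leq_trans k_ge) // [(k * d)%N]mulnC leq_add2l.
  by rewrite leq_pmulr.
have [|s /andP[s_le s_gt]] := @exprn_bracket R b (nu / mu) b_gt1.
  by rewrite ler_pdivlMr // mul1r.
have bs0 : 0 < b%:R ^+ s :> R by rewrite exprn_gt0.
have b1_lt : (b.-1 < b)%N by rewrite prednK // (ltn_trans _ b_gt1).
have [uv uvP] := choice (fun i : {ffun 'I_d -> 'I_(b ^ k)} =>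
  net_close_pair d_gt0 b_gt1 k_le net digits i).
have prefix_uv i j : mkseq (e (uv i).1 j) k = mkseq (e (uv i).2 j) k.
  by have [_ ->] := uvP i.
have box_uv i j : (prefix_int (e (uv i).1 j) k <= i j <= (prefix_int (e (uv i).1 j) k).+1)%N.
  by have [_ _ ->] := uvP i.
pose lo := Ordinal (ltnW b_gt1); pose one := Ordinal b_gt1; pose hi := Ordinal b1_lt.
have := @prob_some_steered R b d k s _ _ P pi owen lo one hi erefl erefl erefl
  (fun i => e (uv i).1) (fun i => e (uv i).2) prefix_uv box_uv.
set U := \bigcup_i _ => U_ge.
have mU : measurable U by exact: (measurable_some_steered s owen).
have U_sub : U `<=` [set o | separation (xt o) <= C * mu / nu ^+ 3].
  move=> o [i _ oi]; have [uv_neq _ _] := uvP i.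
  apply: (le_trans (separation_le (xt o) uv_neq)).
  apply: (@le_trans _ _ (2 / b%:R ^+ (k + s))).
    apply: norm_row_le => [|j]; first by rewrite divr_ge0 ?exprn_ge0 ?ler0n.
    rewrite !mxE; apply: (@steer_close b lo one hi erefl erefl erefl R _ _ _ (fun w => pi j w o)).
    by move=> w /ltnW wL; exact: oi.
  rewrite ler_pdivrMr ?exprn_gt0 // mulrAC ler_pdivlMr ?exprn_gt0 // exprD CE.
  have {s_gt} : nu < b%:R ^+ s * b%:R * mu by rewrite -exprSr -ltr_pdivrMr.
  move=> s_gt; apply: (@le_trans _ _ (2 * ((b%:R ^+ k * c1) * (b%:R ^+ s * b%:R * mu)))).
    by rewrite ler_pM2l // exprSr ler_pM ?exprn_ge0 ?(ltW nu_gt0) ?(ltW s_gt).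
  rewrite [leRHS](_ : _ = (2 ^+ d * 3) * ((b%:R ^+ k * c1) * (b%:R ^+ s * b%:R * mu)));
    last by ring.
  by apply: ler_wpM2r; rewrite ?mulr_ge0 ?(ltW bk0) ?(ltW bs0) ?(ltW b0) ?(ltW mu0)
    ?(ltW c1_gt0) //; lra.
apply: (@le_trans _ _ (P U)); last first.
  by apply: le_measure => //; rewrite inE //; exact: measurable_separation_le.
have mu2 : 0 < mu ^+ 2 by rewrite exprn_gt0.
have C_ge : 2 ^+ d * (3 * c1) <= C.
  by rewrite CE mulrA ler_peMr // !mulr_ge0 ?exprn_ge0 ?(ltW c1_gt0).
(* for small [mu] the claim is void *)
have [small|large] := leP (3 * c1 / mu ^+ 2) 1; last first.
  apply: (@le_trans _ _ 0%E); last exact: measure_ge0.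
  rewrite lee_fin subr_le0 ler_pdivlMr // mul1r (le_trans _ C_ge) //.
  rewrite ltr_pdivlMr // mul1r in large; nra.
apply: le_trans U_ge; rewrite lee_fin.
have y_le : 3 * b%:R ^+ (2 * s) / b%:R ^+ k <= 3 * c1 / mu ^+ 2.
  rewrite ler_pdivrMr // mulrAC ler_pdivlMr // -!mulrA ler_pM2l //.
  rewrite [c1 * _]mulrC; apply: le_trans nu_bk; rewrite mulnC exprM -exprMn.
  by rewrite lerXn2r ?nnegrE ?mulr_ge0 ?(ltW bs0) ?(ltW mu0) ?(ltW nu_gt0) // -ler_pdivlMr.
have y_ge0 : 0 <= 3 * b%:R ^+ (2 * s) / b%:R ^+ k :> R.
  by rewrite divr_ge0 ?mulr_ge0 ?exprn_ge0 // ltW.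
have := exprD1_le d (introT andP (conj y_ge0 (le_trans y_le small))).
have h : 2 ^+ d * (3 * b%:R ^+ (2 * s) / b%:R ^+ k) <= C / mu ^+ 2.
  apply: (@le_trans _ _ (2 ^+ d * (3 * c1 / mu ^+ 2))); first by rewrite ler_wpM2l // ?exprn_ge0.
  by rewrite mulrA ler_wpM2r // invr_ge0 ltW.
lra.
Qed.

Lemma fill_distance_ge_net (y : 'I_(b ^ m) -> 'rV[R]_d) :
  (2 * b%:R * nu ^+ 2)^-1 <= fill_distance y.
Proof.
have N_lt : (b ^ m < (b ^ (m %/ d).+1) ^ d)%N.
  by rewrite -expnM ltn_exp2l // ltn_ceil.
have G_gt0 : (0 < b ^ (m %/ d).+1)%N by rewrite expn_gt0 (ltn_trans _ b_gt1).
apply: le_trans (fill_distance_ge y (ltnW N_gt1) G_gt0 N_lt).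
rewrite lef_pV2 ?posrE ?mulr_gt0 ?exprn_gt0 // ?ltr0n //.
rewrite -mulrA ler_pM2l // natrX exprS ler_pM2l //.
rewrite -(@ler_pXn2r _ d) // ?nnegrE ?exprn_ge0 ?(ltW b0) ?(ltW nu_gt0) //.
by rewrite -!exprM nuX; apply: ler_weXn2l => //; exact: leq_trunc_div.
Qed.

Lemma mesh_ratio_ge (y : 'I_(b ^ m) -> 'rV[R]_d) (mu : R) : 0 < mu ->
  separation y <= C * mu / nu ^+ 3 ->
  (((C * b%:R)^-1 * nu / mu)%:E <= mesh_ratio y)%E.
Proof.
move=> mu0 sep_le; rewrite /mesh_ratio; case: eqP => [_|/eqP sep0]; first exact: leey.
have sep_gt0 : 0 < separation y by rewrite lt_neqAle eq_sym sep0 separation_ge0 // N_gt1.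
have C0 : 0 < C by rewrite ltr0n !muln_gt0 !expn_gt0 (ltn_trans _ b_gt1).
rewrite lee_fin ler_pdivlMr //.
apply: (@le_trans _ _ (2 * (2 * b%:R * nu ^+ 2)^-1)); last first.
  by rewrite ler_pM2l // fill_distance_ge_net.
have coef0 : 0 <= (C * b%:R)^-1 * nu / mu by rewrite !mulr_ge0 ?invr_ge0 ?mulr_ge0 ?ltW.
apply: (le_trans (ler_wpM2l coef0 sep_le)).
rewrite le_eqVlt; apply/orP; left; apply/eqP; field.
by rewrite !gt_eqF.
Qed.

(** Points that coincide are included: both sides are then 0. *)
Lemma mesh_ratio_inv (y : 'I_(b ^ m) -> 'rV[R]_d) (a : R) :
  (a%:E / mesh_ratio y = (a * separation y / (2 * fill_distance y))%:E)%E.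
Proof.
have fill0 : 0 < fill_distance y.
  by apply: lt_le_trans (fill_distance_ge_net y); rewrite invr_gt0 !mulr_gt0 ?exprn_gt0.
rewrite /mesh_ratio; case: eqP => [->|/eqP sep0]; first by rewrite invey mule0 mulr0 mul0r.
rewrite inver mulf_eq0 mulf_eq0 invr_eq0 (negbTE sep0) (gt_eqF fill0) pnatr_eq0 /=.
by rewrite -EFinM invf_div mulrA.
Qed.

Lemma measurable_mesh_gt (a r : R) :
  measurable [set o | (r%:E < `|a%:E / mesh_ratio (xt o)|)%E].
Proof.
have fill0 o : 0 < 2 * fill_distance (xt o).
  by rewrite mulr_gt0 // (lt_le_trans _ (fill_distance_ge_net _)) //
    invr_gt0 !mulr_gt0 ?exprn_gt0.
rewrite (_ : [set o | _] = (fun o => `|a * separation (xt o)| -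
    r * (2 * fill_distance (xt o))) @^-1` `]0, +oo[).
  rewrite -[X in measurable X]setTI.
  have : measurable_fun setT (fun o => `|a * separation (xt o)| -
      r * (2 * fill_distance (xt o))).
    apply: measurable_funB.
      apply: measurableT_comp => //; apply: measurable_funM => //.
      exact: (measurable_separation m_xt).
    apply: measurable_funM => //; apply: measurable_funM => //.
    exact: (measurable_fill_distance m_xt).
  by apply => //; exact: measurable_itv.
by apply/seteqP; split => o; rewrite /= in_itv /= andbT mesh_ratio_inv lte_fin
  subr_gt0 normf_div (gtr0_norm (fill0 o)) ltr_pdivlMr.
Qed.

End FixedSize.

(** * The theorem *)

Lemma expn_powR_cvg (R : realType) (b d : nat) (lambda : R) :
  (1 < b)%N -> (0 < d)%N -> 0 <= lambda ->
  exists M : nat, forall m, (M <= m)%N -> lambda <= ((b ^ m)%:R : R) `^ (d%:R^-1).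
Proof.
move=> b1 d0 l0; have d0R : d%:R != 0 :> R by rewrite pnatr_eq0 -lt0n.
exists (Num.truncn (lambda ^+ d)).+1 => m Mm.
have -> : lambda = (lambda ^+ d) `^ (d%:R^-1).
  by rewrite -powR_mulrn // -powRrM mulfV // powRr1.
apply: ge0_ler_powR; rewrite ?invr_ge0 ?nnegrE ?exprn_ge0 ?ler0n //.
apply: (le_trans (ltW (truncnS_gt (lambda ^+ d)))).
by rewrite ler_nat (leq_trans Mm) // ltnW // ltn_expl.
Qed.

Section RealPowers.
Context (R : realType) (d : nat) (N lambda : R).
Hypotheses (d_gt0 : (0 < d)%N) (N_gt0 : 0 < N) (lambda_gt0 : 0 < lambda).
Let nu := N `^ (1 / (2 * d%:R)).
Let d0 : d%:R != 0 :> R. Proof. by rewrite pnatr_eq0 -lt0n. Qed.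

Lemma powR_rootX n : nu ^+ n = N `^ (n%:R / (2 * d%:R)).
Proof. by rewrite -powR_mulrn ?powR_ge0 // -powRrM mulrAC mul1r. Qed.

Lemma powR_rootX_full : nu ^+ (2 * d) = N.
Proof. by rewrite powR_rootX natrM divff ?powRr1 ?ltW // mulf_neq0. Qed.

Lemma powR_root2 : nu ^+ 2 = N `^ (d%:R^-1).
Proof. by rewrite powR_rootX; congr (_ `^ _); field. Qed.

Lemma powR_rootN3 : N `^ (- (3 / (2 * d%:R))) = (nu ^+ 3)^-1.
Proof. by rewrite powRN powR_rootX. Qed.

Lemma powR_half2 : (lambda `^ (1 / 2)) ^+ 2 = lambda.
Proof. by rewrite -powR_mulrn ?powR_ge0 // -powRrM mul1r mulVf // powRr1 // ltW. Qed.

End RealPowers.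

Lemma abse_div_le (R : realType) (a r : R) (y : \bar R) : 0 <= a -> 0 < r ->
  (r%:E <= y)%E -> (`|a%:E / y| <= (a / r)%:E)%E.
Proof.
move=> a0 r0; case: y => [y| |] //; rewrite ?lee_fin.
  move=> ry; have y0 : 0 < y by apply: lt_le_trans ry.
  rewrite inver gt_eqF // -EFinM abse_EFin lee_fin ger0_norm ?divr_ge0 ?(ltW y0) //.
  by rewrite ler_wpM2l // lef_pV2.
by rewrite mulr0 normr0 divr_ge0 // ltW.
Qed.

Section Tails.
Context (R : realType) (b d t : nat) (m0 : nat) (C : R).
Context (disp : nat -> measure_display) (Omega : forall m, measurableType (disp m)).
Variable P : forall m, probability (Omega m) R.
Hypotheses (b_gt1 : (1 < b)%N) (d_gt0 : (0 < d)%N).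

(** The probability bound is [C / lambda] for an arbitrary [lambda], once [m] is
    large: choosing [lambda = C / eps] turns it into a bound in probability. *)
Lemma bigO_P_of_tail (X : forall m, Omega m -> \bar R) (a : nat -> R)
    (K : R -> R) :
  (forall lambda, 1 <= lambda -> 0 < K lambda) ->
  (forall m, (m0 <= m)%N -> forall lambda,
    1 <= lambda <= ((b ^ m)%:R : R) `^ (d%:R^-1) ->
    (P m [set o | ((K lambda * a m)%:E < `|X m o|)%E] <= (C / lambda)%:E)%E) ->
  bigO_P P X a.
Proof.
move=> K0 tail eps eps0; set lambda := Num.max 1 (C / eps).
have l1 : 1 <= lambda by rewrite le_max lexx.
have l_gt0 : 0 < lambda by apply: lt_le_trans l1.
have [M lM] := @expn_powR_cvg R b d lambda b_gt1 d_gt0 (ltW l_gt0).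
exists (K lambda); split; first exact: K0.
exists (maxn m0 M) => m; rewrite geq_max => /andP[m0m Mm].
apply: (le_trans (tail m m0m lambda _)); first by rewrite l1 lM.
by rewrite lee_fin ler_pdivrMr // mulrC -ler_pdivrMr // le_max lexx orbT.
Qed.

Lemma probability_le_setC m (A B : set (Omega m)) (p : R) :
  measurable A -> measurable B -> B `<=` ~` A -> ((1 - p)%:E <= P m A)%E ->
  (P m B <= p%:E)%E.
Proof.
move=> mA mB BA pA; apply: (@le_trans _ _ (P m (~` A))).
  by apply: le_measure; rewrite ?inE //; exact: measurableC.
rewrite probability_setC // leeBlDr ?fin_num_measure //.
by rewrite -leeBlDl // -EFinB.
Qed.

End Tails.

Unset Implicit Arguments.
Set Strict Implicit.
Set Printing Implicit Defensive.

Theorem corollary4p4 (R : realType) (t d b : nat) (hd : (1 <= d)%N) (hb : (2 <= b)%N) :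
  exists (c C : R) (m0 : nat), 0 < c /\ 0 < C /\
  forall (disp : nat -> measure_display)
    (Omega : forall m, measurableType (disp m))
    (P : forall m, probability (Omega m) R)
    (x : forall m, 'I_(b ^ m) -> 'rV[R]_d)
    (e : forall m, 'I_(b ^ m) -> 'I_d -> nat -> 'I_b)
    (pi : forall m, 'I_d -> seq 'I_b -> Omega m -> {perm 'I_b}),
    (forall m, (t <= m)%N -> is_net t (x m)) ->
    (forall m, (t <= m)%N -> are_digits (x m) (e m)) ->
    (forall m, (t <= m)%N -> owen_permutations (P m) (pi m)) ->
    let N := fun m : nat => (b ^ m)%:R : R in
    let xt := fun (m : nat) (o : Omega m) => scramble R (pi m) (e m) o in
    [/\ forall m : nat, (t <= m)%N -> (m0 <= m)%N ->
          forall lambda : R, 1 <= lambda <= N m `^ (d%:R^-1) ->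
          ((1 - C * lambda^-1)%:E <=
           P m [set o |
             (separation (xt m o) <=
                C * N m `^ (- (3 / (2 * d%:R))) * lambda `^ (1 / 2))%R /\
             ((c * N m `^ (1 / (2 * d%:R)) * lambda `^ (- (1 / 2)))%:E <=
                mesh_ratio (xt m o))%E])%E,
        bigO_P P (fun m o => (separation (xt m o))%:E)
          (fun m => N m `^ (- (3 / (2 * d%:R)))) &
        bigOmega_P P (fun m o => mesh_ratio (xt m o))
          (fun m => N m `^ (1 / (2 * d%:R)))].
Proof.
have b0 : 0 < b%:R :> R by rewrite ltr0n ltnW.
pose C : R := (scrambling_constant b d t)%:R.
have C0 : 0 < C by rewrite ltr0n !muln_gt0 !expn_gt0 (ltnW hb).
exists (C * b%:R)^-1, C, (t + d.+1)%N; split; first by rewrite invr_gt0 mulr_gt0.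
split=> // disp Omega P x e pi net digits owen N xt.
pose nu m := N m `^ (1 / (2 * d%:R)).
have N0 m : 0 < N m by rewrite ltr0n expn_gt0 (ltnW hb).
have nu0 m : 0 < nu m by rewrite powR_gt0.
have nuX m : nu m ^+ (2 * d) = b%:R ^+ m by rewrite powR_rootX_full // /N natrX.
have tm m : (t + d.+1 <= m)%N -> (t <= m)%N by apply: leq_trans; rewrite leq_addr.
pose S lambda m : set (Omega m) :=
  [set o | separation (xt m o) <= C * N m `^ (- (3 / (2 * d%:R))) * lambda `^ (1 / 2)].
have SE lambda m : C * N m `^ (- (3 / (2 * d%:R))) * lambda `^ (1 / 2) =
    C * lambda `^ (1 / 2) / nu m ^+ 3 by rewrite powR_rootN3 mulrAC.
have mS lambda m : (t + d.+1 <= m)%N -> measurable (S lambda m).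
  move=> m_ge; rewrite /S SE.
  exact: (measurable_separation_le hd hb m_ge (e m) (owen m (tm m m_ge))).
have PS lambda m : (t + d.+1 <= m)%N -> 1 <= lambda <= N m `^ (d%:R^-1) ->
    ((1 - C / lambda)%:E <= P m (S lambda m))%E.
  move=> m_ge /andP[l1 lN]; have l0 : 0 < lambda by apply: lt_le_trans l1.
  have m_t := tm m m_ge.
  rewrite -[X in (1 - C / X)%:E]powR_half2 // /S SE.
  apply: (prob_separation_le hd hb m_ge (net m m_t) (digits m m_t) (owen m m_t)
    (nu0 m) (nuX m)).
    by rewrite -[leLHS](powRr0 lambda); apply: ler_powR; rewrite // divr_ge0.
  by rewrite -(@ler_pXn2r _ 2) // ?nnegrE ?powR_ge0 // powR_half2 // powR_root2.
have mesh_S lambda m (o : Omega m) : (t + d.+1 <= m)%N -> 0 < lambda -> S lambda m o ->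
    (((C * b%:R)^-1 * nu m / lambda `^ (1 / 2))%:E <= mesh_ratio (xt m o))%E.
  rewrite /S /= SE => m_ge l0 oS; apply: (mesh_ratio_ge hd hb m_ge (nu0 m) (nuX m)) oS.
  by rewrite powR_gt0.
split.
- move=> m _ m_ge lambda l_bnd; have /andP[l1 _] := l_bnd.
  have l0 : 0 < lambda by apply: lt_le_trans l1.
  (* the bound on the mesh ratio follows from the one on the separation *)
  rewrite [X in P m X](_ : _ = S lambda m); first exact: PS.
  apply/seteqP; split => o; first by case.
  by move=> oS; split => //=; rewrite powRN; exact: mesh_S.
- apply: (bigO_P_of_tail (m0 := (t + d.+1)%N)
    (K := fun lambda => C * lambda `^ (1 / 2)) hb hd) => [lambda l1|m m_ge lambda l_bnd].
    by rewrite mulr_gt0 // powR_gt0 // (lt_le_trans ltr01).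
  have setE : [set o | ((C * lambda `^ (1 / 2) * N m `^ (- (3 / (2 * d%:R))))%:E <
      `|(separation (xt m o))%:E|)%E] = ~` S lambda m.
    have sep0 o : 0 <= separation (xt m o).
      by apply: separation_ge0; apply: leq_trans (ltn_expl _ hb); lia.
    apply/seteqP; split => o; rewrite /S /= lte_fin (mulrAC C) ger0_norm //.
      by rewrite ltNge => /negP.
    by move/negP; rewrite -ltNge.
  rewrite setE; apply: (probability_le_setC (mS lambda m m_ge)) => //.
    exact/measurableC/mS.
  exact: PS.
- apply: (bigO_P_of_tail (m0 := (t + d.+1)%N)
    (K := fun lambda => C * b%:R * lambda `^ (1 / 2)) hb hd) => [lambda l1|m m_ge lambda l_bnd].
    by rewrite !mulr_gt0 // powR_gt0 // (lt_le_trans ltr01).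
  have /andP[l1 _] := l_bnd; have l0 : 0 < lambda by apply: lt_le_trans l1.
  apply: (probability_le_setC (mS lambda m m_ge) _ _ (PS lambda m m_ge l_bnd)).
    exact: (measurable_mesh_gt hd hb m_ge (e m) (owen m (tm m m_ge)) (nu0 m) (nuX m)).
  move=> o /= + oS; apply/negP; rewrite -leNgt mulr1.
  have := mesh_S lambda m o m_ge l0 oS.
  have r0 : 0 < (C * b%:R)^-1 * nu m / lambda `^ (1 / 2).
    by rewrite !mulr_gt0 ?invr_gt0 ?mulr_gt0 ?powR_gt0.
  move=> /(abse_div_le (ltW (nu0 m)) r0) /le_trans; apply.
  rewrite lee_fin le_eqVlt; apply/orP; left; apply/eqP; field.
  by rewrite !gt_eqF ?powR_gt0.
Qed.
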